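(* Let $\hat D,\hat N,\hat M,\hat w$ be non-negative integers such that (i) $\hat N\geq 3\hat w$; (ii) $\hat D^2\geq 4\hat N\hat w$; and (iii) $\hat M\hat D\geq 2\hat N\hat w$. Let $S_1,\ldots,S_{\hat M}$ be subsets of $\{1,\ldots,\hat N\}$ with $|S_i|\geq\hat D$ for each $1\le i\le\hat M$. Then there are $\hat w$ indices $1\leq i_1<i_2<\cdots<i_{\hat w}\leq\hat M$ such that $|S_{i_j}\cap S_{i_{j+1}}|\geq\hat w$ for all $1\leq j<\hat w$. *)

(* Defs.v *)
From mathcomp Require Export all_boot.

(* Main.v *)
Require Import Defs.
From mathcomp Require Import all_boot.
From mathcomp Require Import zify.

(** Join indices [x < y] whenever [S x] and [S y] share at least [w] points.
    Repeatedly discarding the vertices without predecessor removes independent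
    sets, so if these have at most [a] elements and [(w - 1) * a < M], then a
    path on [w] vertices exists.  An independent set [A] satisfies
    [#|A| * D < 2 * N]: otherwise take [k] of its elements with
    [2 * N <= k * D < 2 * N + D]; the Bonferroni inequality
    [k * D <= N + 'C(k, 2) * w] then contradicts [4 * N * w <= D ^ 2]. *)

Set Implicit Arguments.
Unset Strict Implicit.
Unset Printing Implicit Defensive.

Lemma exists_path_of_independent_bound (T : finType) (r : rel T) (a : nat)
    (ra : forall A : {set T}, {in A &, forall x y, ~~ r x y} -> #|A| <= a)
    (n : nat) (B : {set T}) :
  n * a < #|B| -> exists2 x, x \in B & exists2 s, size s = n & path r x s.
Proof.
elim: n B => [|n IHn] B.
  by rewrite mul0n => /card_gt0P[x xB]; exists x => //; exists [::].
(* No edge joins two vertices of [B :\: B'], so at most [a] vertices are lost; a path starting in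
   [B'] is then extended at the front by a predecessor in [B]. *)
move=> lt_na; pose B' := [set y in B | [exists x in B, r x y]].
have cardD : #|B :\: B'| <= a.
  apply: ra => x y; rewrite !inE => /andP[_ xB] /andP[yB' yB].
  apply: contra yB' => rxy; rewrite yB /=.
  by apply/existsP; exists x; rewrite xB.
have cardI : #|B :&: B'| <= #|B'| by rewrite subset_leq_card // subsetIr.
have lt_na' : n * a < #|B'| by have := cardsID B' B; lia.
have [y yB' [s size_s path_s]] := IHn _ lt_na'.
move: yB'; rewrite inE => /andP[_ /existsP[x /andP[xB rxy]]].
by exists x => //; exists (y :: s); rewrite /= ?size_s ?rxy.
Qed.

(** Adjoining [x] to [s] costs the overlap of [S x] with the union over [s], at most [size s * c];
    by Pascal's rule the binomial grows by exactly [size s]. *)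
Lemma bonferroni_card (I : eqType) (T : finType) (S : I -> {set T}) (c : nat)
    (s : seq I) :
  uniq s -> {in s &, forall i j, i != j -> #|S i :&: S j| <= c} ->
  \sum_(i <- s) #|S i| <= #|\bigcup_(i <- s) S i| + 'C(size s, 2) * c.
Proof.
elim: s => [|x s IHs] /=; first by rewrite !big_nil.
move=> /andP[xs uniq_s] Sc; rewrite !big_cons binS bin1.
have {}IHs := IHs uniq_s (fun i j si sj =>
  Sc i j (mem_behead (s := x :: s) si) (mem_behead (s := x :: s) sj)).
have card_xs : #|S x :&: \bigcup_(i <- s) S i| <= size s * c.
  have : {in s, forall i, #|S x :&: S i| <= c}.
    move=> i si; apply: Sc; rewrite ?mem_head ?in_cons ?si ?orbT //.
    by apply: contraNneq xs => ->.
  elim: s {xs uniq_s Sc IHs} => [|y s IHs] cap_c.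
    by rewrite big_nil setI0 cards0.
  rewrite big_cons setIUr mulSn (leq_trans (leq_card_setU _ _)) //.
  rewrite leq_add ?cap_c ?mem_head // IHs // => i si.
  by rewrite cap_c // in_cons si orbT.
have := cardsUI (S x) (\bigcup_(i <- s) S i); lia.
Qed.

Lemma card_independent_bound (I T : finType) (S : I -> {set T}) (D c : nat)
    (A : {set I}) :
  0 < #|T| -> 0 < D -> 4 * #|T| * c <= D ^ 2 ->
  (forall i, D <= #|S i|) ->
  {in A &, forall i j, i != j -> #|S i :&: S j| <= c} ->
  #|A| * D < 2 * #|T|.
Proof.
move=> T_gt0 D_gt0 hD hS Sc; rewrite ltnNge; apply/negP => le_A.
have exk : exists k, 2 * #|T| <= k * D by exists #|A|.
case: (ex_minnP exk) => k le_k min_k; have k_le := min_k _ le_A.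
have lt_k1 : k.-1 * D < 2 * #|T|.
  rewrite ltnNge; apply/negP => /min_k; case: k le_k {min_k k_le}; lia.
pose s := take k (enum A).
have size_s : size s = k by rewrite size_takel // -cardE.
have := @bonferroni_card I T S c s (take_uniq _ (enum_uniq _)).
rewrite size_s => bonf.
have {}bonf : k * D <= #|T| + 'C(k, 2) * c.
  apply: (@leq_trans (\sum_(i <- s) #|S i|)).
    by rewrite -size_s -sum1_size big_distrl leq_sum //= => i _; rewrite mul1n.
  apply: leq_trans (bonf _) _; last by rewrite leq_add2r max_card.
  by move=> i j /mem_take + /mem_take; rewrite !mem_enum; exact: Sc.
have bin2k : 2 * 'C(k, 2) = k * k.-1 by rewrite -mul_bin_diag bin1.
have le1 : 2 * (k * D) <= 2 * #|T| + k * k.-1 * c by rewrite -bin2k; lia.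
have le2 : k * k.-1 * (4 * #|T| * c) <= k * k.-1 * D ^ 2.
  by rewrite leq_mul2l hD orbT.
have le3 : (k * D) * (k.-1 * D) <= (k * D) * (2 * #|T|).
  by rewrite leq_mul2l (ltnW lt_k1) orbT.
have le4 : 4 * #|T| * (2 * (k * D)) <= 4 * #|T| * (2 * #|T| + k * k.-1 * c).
  by rewrite leq_mul2l le1 orbT.
have le5 : #|T| * (2 * #|T|) <= #|T| * (k * D).
  by rewrite leq_mul2l le_k orbT.
have T2_gt0 : 0 < #|T| * #|T| by rewrite muln_gt0 T_gt0.
(* With [N] for [#|T|], [le4], [le2] and [le3] chain to [6 * N * k * D <= 8 * N ^ 2], whereas [le5]
   gives [12 * N ^ 2 <= 6 * N * k * D]. *)
nia.
Qed.

(* MathComp. The set {1, ..., n} is represented by the ordinals of type I_n. *)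
Theorem theorem4p20 (D N M w : nat)
    (hN : N >= 3 * w)
    (hD : D ^ 2 >= 4 * N * w)
    (hM : M * D >= 2 * N * w)
    (S : 'I_M -> {set 'I_N})
    (hS : forall i : 'I_M, #|S i| >= D) :
  exists i : 'I_w -> 'I_M,
    (forall j k : 'I_w, j < k -> i j < i k) /\
    (forall j k : 'I_w, k = j.+1 :> nat -> #|S (i j) :&: S (i k)| >= w).
Proof.
case: w hN hD hM => [|w] hN hD hM.
  have i0 (j : 'I_0) : 'I_M by case: j.
  by exists i0; split; case.
have N_gt0 : 0 < N by lia.
have D_gt0 : 0 < D by case: D hD {hM hS} => //; lia.
pose lt_ord : rel 'I_M := fun x y => x < y.
(* The original [w] is now [w.+1], hence the strict inequality. *)
pose meets : rel 'I_M := fun x y => w < #|S x :&: S y|.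
have indep (A : {set 'I_M}) :
    {in A &, forall x y, ~~ (lt_ord x y && meets x y)} -> #|A| <= 2 * N %/ D.
  move=> indepA; rewrite leq_divRL //.
  have := @card_independent_bound _ 'I_N S D w.+1 A.
  rewrite card_ord => /(_ N_gt0 D_gt0 hD hS) lt_A; apply/ltnW/lt_A => x y xA yA.
  (* Non-adjacency leaves at most [w] common points; [leqW] weakens this to the [w.+1] that matches
     [hD]. *)
  rewrite neq_ltn => /orP[lt_xy|lt_yx]; apply: leqW; rewrite leqNgt.
    by have := indepA x y xA yA; rewrite /lt_ord lt_xy.
  by rewrite setIC; have := indepA y x yA xA; rewrite /lt_ord lt_yx.
(* A path on [w.+1] vertices has [w] edges, so only [w] layers are discarded. After multiplication
   by [D] they cost at most [2 * N * w], which is [2 * N > 0] below the bound in [hM]. *)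
have lt_wM : w * (2 * N %/ D) < #|[set: 'I_M]|.
  rewrite cardsT card_ord -(ltn_pmul2r D_gt0) -mulnA.
  apply: leq_trans hM; rewrite mulnS addnC.
  have := leq_mul (leqnn w) (leq_divM (2 * N) D); nia.
have [x _ [s size_s path_s]] := exists_path_of_independent_bound indep lt_wM.
have [sorted_lt sorted_meets] : sorted lt_ord (x :: s) /\ sorted meets (x :: s).
  by split; apply: sub_path path_s => y z /andP[].
have lt_size (j : 'I_w.+1) : j < size (x :: s) by rewrite /= size_s.
exists (fun j => nth x (x :: s) j); split=> [j k lt_jk|j k kE].
  have lt_ord_trans : transitive lt_ord by move=> ? ? ?; exact: ltn_trans.
  by apply: (sorted_ltn_nth lt_ord_trans x sorted_lt) => //; rewrite inE.
by rewrite kE; apply: (pathP x sorted_meets); rewrite -ltnS -kE; exact: lt_size.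
Qed.
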